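(* There exists a Köthe sequence space $X$ such that $X$ supports a frequently hypercyclic (unilateral) weighted shift but does not support any chaotic (unilateral) weighted shift; that is, there is a sequence $w$ of positive real numbers for which $B_w$ is a continuous frequently hypercyclic operator on $X$, while for no sequence $w$ of positive real numbers is $B_w$ a continuous chaotic operator on $X$.
   Context: Let $A=(a_{m,n})_{m\ge1,\,n\ge0}$ be a matrix of strictly positive numbers such that $a_{m,n}\le a_{m+1,n}$ for all $m\ge1$, $n\ge0$. The Köthe sequence space of order $p$ ($1\le p<+\infty$) is $$\lambda^p(A)=\Big\{x=(x_n)_{n\ge0}:\ \forall m\ge1,\ \sum_{n\ge0}|x_n|^p a_{m,n}<+\infty\Big\},$$ with the Fréchet topology given by the seminorms $\|x\|_m=\big(\sum_{n\ge 0}|x_n|^pa_{m,n}\big)^{1/p}$, $m\geq 1$; the Köthe sequence space of order $0$ is $$c_0(A)=\Big\{x=(x_n)_{n\ge0}:\ \forall m\ge1,\ \lim_{n\to+\infty}|x_n|a_{m,n}=0\Big\},$$ with the Fréchet topology given by the seminorms $\|x\|_m=\sup_{n\ge 0}|x_n|a_{m,n}$, $m\geq 1$. Sequences are complex-valued. A Köthe sequence space is a space of one of these forms. For a sequence $w=(w_n)$ of positive real numbers, the unilateral weighted shift is $B_w\big((x_n)_{n\ge0}\big)=(w_{n+1}x_{n+1})_{n\ge0}$. A space $X$ supports a weighted shift $B_w$ with some property if $B_w$ maps $X$ into $X$ continuously and has that property. A continuous linear operator $T$ on a separable Fréchet space $X$ is chaotic if it admits a dense orbit (some $x\in X$ with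 $\{T^nx:n\ge0\}$ dense in $X$) and has a dense set of periodic points. It is frequently hypercyclic if there exists $x\in X$ such that for every nonempty open subset $U$ of $X$, $\underline{\mathrm{dens}}\{n\ge0:T^nx\in U\}>0$, where for $E\subset\{0,1,2,\dots\}$, $\underline{\mathrm{dens}}(E)=\liminf_{N\to+\infty}\frac{1}{N+1}\,\mathrm{card}\{n\le N:\ n\in E\}$. *)

(* Defs.v *)
From HB Require Import structures.
From mathcomp Require Import all_boot all_order all_algebra.
From mathcomp Require Import all_classical all_reals all_analysis.
From mathcomp Require Export complex.

Set Implicit Arguments.
Unset Strict Implicit.
Unset Printing Implicit Defensive.

Import Order.TTheory GRing.Theory Num.Theory.
Import numFieldNormedType.Exports.

Local Open Scope classical_set_scope.
Local Open Scope ring_scope.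

(* Rows are indexed from 0 instead of 1: the entry a_{m,n}, m >= 1, of the
   mathematical matrix is [a m.-1 n]. *)
Record kothe_matrix (R : realType) := KotheMatrix {
  kothe_coef :> nat -> nat -> R ;
  kothe_coef_gt0 : forall m n, 0 < kothe_coef m n ;
  kothe_coef_le : forall m n, kothe_coef m n <= kothe_coef m.+1 n }.

Inductive kothe_order (R : realType) :=
  | KotheZero
  | KotheExp (p : R) of 1 <= p.

Section kothe_space.
Variables (R : realType) (a : kothe_matrix R) (o : kothe_order R).

(* [`|z|] lives in R[i]; [normc z] is the same modulus, in R. *)
Definition kothe_set : set (nat -> R[i]) :=
  match o with
  | KotheZero =>
      [set x | forall m, (fun n => Normc.normc (x n) * a m n) @ \oo --> (0 : R)]
  | KotheExp p _ =>
      [set x | forall m,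
        (\sum_(0 <= n <oo) (Normc.normc (x n) `^ p * a m n)%:E < +oo)%E]
  end.

(* Total on all sequences, with value +oo where the sum or the supremum
   diverges. *)
Definition kothe_seminorm (m : nat) (x : nat -> R[i]) : \bar R :=
  match o with
  | KotheZero => ereal_sup (range (fun n => (Normc.normc (x n) * a m n)%:E))
  | KotheExp p _ =>
      poweR (\sum_(0 <= n <oo) (Normc.normc (x n) `^ p * a m n)%:E)%E p^-1
  end.

Record kothe_space := KotheSpace {
  kothe_seq :> nat -> R[i] ;
  kothe_seqP : kothe_set kothe_seq }.

HB.instance Definition _ := gen_eqMixin kothe_space.
HB.instance Definition _ := gen_choiceMixin kothe_space.

Definition kothe_ball (x : kothe_space) (M : nat) (e : R) : set kothe_space :=
  [set y : kothe_space | forall m, (m <= M)%N ->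
    (kothe_seminorm m (fun n => (y n - x n)%R) < e%:E)%E].

Definition kothe_open : set_system kothe_space :=
  [set U : set kothe_space | forall x, U x -> exists M (e : R), 0 < e /\ kothe_ball x M e `<=` U].

Lemma kothe_openT : kothe_open setT.
Proof. by move=> x _; exists 0%N, 1; split. Qed.

Lemma kothe_openI : setI_closed kothe_open.
Proof.
move=> U V oU oV x [/oU[M [e [e0 sU]]] /oV[N [f [f0 sV]]]].
exists (maxn M N), (Num.min e f); split; first by rewrite lt_min e0.
move=> y Bxy; split.
- apply: sU => m mM.
  have /lt_le_trans := Bxy m (leq_trans mM (leq_maxl _ _)); apply.
  by rewrite lee_fin ge_min lexx.
- apply: sV => m mN.
  have /lt_le_trans := Bxy m (leq_trans mN (leq_maxr _ _)); apply.
  by rewrite lee_fin ge_min lexx orbT.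
Qed.

Lemma kothe_open_bigU (I : Type) (f : I -> set kothe_space) :
  (forall i, kothe_open (f i)) -> kothe_open (\bigcup_i f i).
Proof.
move=> of_ x [i _ /of_[M [e [e0 sf]]]]; exists M, e; split=> //.
by move=> y /sf fy; exists i.
Qed.

HB.instance Definition _ :=
  isOpenTopological.Build kothe_space kothe_openT kothe_openI kothe_open_bigU.

End kothe_space.

Section dynamics.
Variable X : topologicalType.
Implicit Types T : X -> X.

Definition periodic_point T (x : X) := exists2 n, (0 < n)%N & iter n T x = x.

Definition chaotic T :=
  (exists x, dense (range (fun n => iter n T x))) /\
  dense [set x | periodic_point T x].

End dynamics.

Definition lower_density (R : realType) (E : set nat) : \bar R :=
  limn_einf (fun N => (#|[pred n : 'I_N.+1 | `[< E n >]]|%:R / N.+1%:R)%:E).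

Definition frequently_hypercyclic (R : realType) (X : topologicalType)
    (T : X -> X) :=
  exists x, forall U : set X, open U -> U !=set0 ->
    (0 < lower_density R [set n | U (iter n T x)])%E.

Definition weighted_shift (R : realType) (w : nat -> R) (x : nat -> R[i]) :
    nat -> R[i] :=
  fun n => (w n.+1)%:C%C * x n.+1.

(* The weights are positive, and B_w restricts to a continuous self-map T of X
   which has property P.  No linearity is required of T because B_w is linear. *)
Definition supports_shift (R : realType) (a : kothe_matrix R)
    (o : kothe_order R) (P : (kothe_space a o -> kothe_space a o) -> Prop)
    (w : nat -> R) :=
  (forall n, 0 < w n) /\
  exists T : kothe_space a o -> kothe_space a o,
    [/\ forall x, kothe_seq (T x) = weighted_shift w (kothe_seq x),
        continuous T & P T].

Arguments supports_shift {R} a o P w.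

(* Main.v *)
Require Import Defs.
From mathcomp Require Import all_boot all_order all_algebra.
From mathcomp Require Import all_classical all_reals all_analysis.
From mathcomp Require Import zify ring lra.

(** The space is a c_0(A), and the frequently hypercyclic operator on it is the
unweighted shift B, with all weights equal to 1.

The matrix.  Fix a very sparse set of integers, the peaks, and let s(n) be the
distance from n down to the last peak.  With F a function of superexponential
growth, put a_{m,n} = F(n)^(m - s(n)) / 2^s(n), where m - s(n) is truncated at
0.  At a peak N the rows a_{0,N}, a_{1,N}, a_{2,N}, ... are the powers of F(N);
after the peak row m goes down by one factor F per step, and it is the small
number 2^-s(n) as soon as s(n) >= m.  Since s(n+1) <= s(n) + 1, one has
a_{m,n} <= 2 a_{m+1,n+1}, so B is continuous (spike_shift).

No chaos.  If B_w has a periodic point x with x_0 <> 0 then, writing v_n for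
w_1 ... w_n, the vectors x, B_w x, B_w^2 x, ... of its finite orbit together
have a coordinate x_0 / v_n at every n, hence a_{m,n} / v_n tends to 0 for
every m (c0_chaotic_cvg).  But continuity of B_w, applied to row 0, gives k and C
with w_{n+1} a_{0,n} <= C a_{k,n+1}; as a_{0,n} >= 2^-n, this bounds v_N by
F(N)^k times a quantity that depends on C, k, N and the values of F before N.
F grows so fast that this quantity is at most F(N) for large N, so a_{k+1,N} =
F(N)^(k+1) >= v_N at every large peak N: a contradiction (spike_no_chaos).

Frequent hypercyclicity.  Take finitely supported vectors y_0, y_1, ... that
are dense, and sets E_0, E_1, ... of positive lower density.  Let x be the
vector that carries a copy of y_p starting at each n in E_p.  For n in E_p,
B^n x differs from y_p by the copies of the y_q starting at the differences
n' - n with n' in E_q, n' > n.  These are small in the first p rows as soon as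
n' - n stays away from the peaks, at a distance h(max(p,q)) dictated by the
lengths and sizes of the y's (orbit_vector_approx).

The sets E_p (sieve).  Let L_0 | L_1 | ... be odd numbers of very fast growth,
and take the numbers (L_i - 1)/2 as peaks.  Far peaks are one half below an
odd multiple of L_(p+1)/2 while the positive elements of L_(p+1) Z differ by
multiples of L_(p+1): these differences are far from those peaks, and greater
than the others.  So E_p can be the multiples of L_(p+1), except that those
which interfere with a sparser E_q, q > p, have to be removed.  They lie near
positive multiples of L_(q+1)/2, hence are rare: a union bound over q shows
that a fixed fraction of the multiples of L_(p+1) survives (sieve_count). *)

Set Implicit Arguments.
Unset Strict Implicit.
Unset Printing Implicit Defensive.

Import Order.TTheory GRing.Theory Num.Theory.
Import numFieldNormedType.Exports.
Import Normc.

(** * Sets of positive density whose differences avoid a sparse sequence *)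

Section sieve.
Variable h : nat -> nat.

(** The factor by which [scale] grows is odd, which keeps the half-integer
structure of the peaks, and so large that level [q] removes few of the multiples
of [scale q]; the power of 2 makes the proportions removed summable over [q]. *)
Fixpoint scale q :=
  if q is q'.+1 then
    scale q' * (2 * (24 * 2 ^ q * (scale q' + 2 * h q' + 1)) + 1)
  else 1.

(** The gap covers both the distance [h q] to be kept from the peaks and the
peaks below [scale q], all the peaks that are not controlled by parity. *)
Definition gap q := scale q + 2 * h q + 1.

Definition peak i := (scale i)./2.

(** Multiples of [scale q.+1] are to be avoided because of the small peaks, odd
multiples of its half because of the large ones. The positivity of [k] leaves
a long initial segment untouched, without which the union of these sets over
all [q] would have no reason to be small. *)
Definition near_half_multiple q n :=
  exists k, [/\ 0 < k, 2 * n <= k * scale q.+1 + gap q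
                     & k * scale q.+1 <= 2 * n + gap q].

Definition sieve p n :=
  [/\ 0 < n, scale p.+1 %| n & forall q, p < q -> ~ near_half_multiple q n].

Lemma scaleS q : scale q.+1 = scale q * (2 * (24 * 2 ^ q.+1 * gap q) + 1).
Proof. by []. Qed.

Arguments scale : simpl never.

Lemma odd_scale q : odd (scale q).
Proof. by elim: q => // q IH; rewrite scaleS oddM IH oddD oddM. Qed.

Lemma scale_gt0 q : 0 < scale q.
Proof. exact/odd_gt0/odd_scale. Qed.

Lemma double_peak i : 2 * peak i + 1 = scale i.
Proof. by rewrite /peak -[RHS]odd_double_half odd_scale; lia. Qed.

Lemma scale_gap q : 48 * 2 ^ q.+1 * gap q * scale q <= scale q.+1.
Proof.
by rewrite scaleS mulnC leq_pmul2l ?scale_gt0// !mulnA leq_addr.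
Qed.

Lemma scale_gap4 q : 4 * gap q <= scale q.+1.
Proof.
apply: leq_trans (scale_gap q).
have -> : 48 * 2 ^ q.+1 * gap q * scale q = 4 * gap q * (12 * (2 ^ q.+1 * scale q)).
  by move: (2 ^ _) => x; lia.
by rewrite leq_pmulr// !muln_gt0 expn_gt0 scale_gt0.
Qed.

Lemma scale_dvd p q : p <= q -> scale p %| scale q.
Proof.
move/subnK <-; elim: (q - p) => // k IH.
by rewrite addSn scaleS dvdn_mulr.
Qed.

Lemma scale_leS q : scale q < scale q.+1.
Proof. have := scale_gap4 q; rewrite /gap; lia. Qed.

Lemma scale_gtid q : q < scale q.
Proof. by elim: q => // q IH; have := scale_leS q; lia. Qed.

Lemma scale_le p q : p <= q -> scale p <= scale q.
Proof. by move=> pq; apply/dvdn_leq/scale_dvd => //; exact: scale_gt0. Qed.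

Lemma peak0 : peak 0 = 0. Proof. by []. Qed.

Lemma peak_lt i : peak i < peak i.+1.
Proof.
have := double_peak i; have := double_peak i.+1; have := scale_leS i.
have := odd_scale i; have := odd_scale i.+1; lia.
Qed.

Lemma peak_odd_multiple q i : q < i ->
  exists2 c, odd c & 2 * peak i + 1 = c * scale q.+1.
Proof.
rewrite double_peak => /scale_dvd/dvdnP[c eqc]; exists c => //.
by move: (odd_scale i); rewrite eqc oddM => /andP[].
Qed.

Lemma peak_le q i : i <= q -> 2 * peak i < scale q.
Proof. by move=> /scale_le; rewrite -(double_peak i) addn1. Qed.

Lemma sieve_ge p n : sieve p n -> scale p.+1 <= n.
Proof. by case=> n0 /dvdn_leq-/(_ n0). Qed.

(** An element of the coarser set is itself near a multiple, so that it has been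
removed from the finer one. *)
Lemma sieve_disjoint p q n : sieve p n -> sieve q n -> p = q.
Proof.
wlog pq : p q / p <= q => [W|].
  by case: (leqP p q) => [/W|/ltnW/W W' Ep Eq]; [exact|rewrite W'].
move: pq; rewrite leq_eqVlt => /predU1P[->//|pq] [_ _ /(_ _ pq) nV] [n0 /dvdnP[k nk] _].
case: nV; exists (2 * k); split; nia.
Qed.

(** A difference close to a peak would place [n] near an integer multiple of
[scale q.+1] if the peak is small, near an odd multiple of its half if the
peak is large. For [p < q] this is excluded by the sieve, and for [p = q] by
the divisibility of [n] and [n'], which rules out small differences and, by
parity, those close to large peaks. *)
Lemma sieve_dist_le p q n n' d : p <= q -> sieve p n -> sieve q n' ->
  0 < d -> n + d = n' \/ n' + d = n ->
  h q < d /\ forall i, d + h q < peak i \/ peak i + h q < d.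
Proof.
move=> pq Ep Eq d0 dE.
have [n0 _ nV] := Ep; have [n'0 /dvdnP[k' n'E] _] := Eq.
have k'0 : 0 < k' by case: k' n'E n'0 => // ->.
have gL := scale_gap4 q; have sq := scale_gt0 q.
have {}nV : (exists2 k, 0 < k & n = k * scale q.+1) \/ ~ near_half_multiple q n.
  case: (ltngtP p q) pq => // [/nV|<- _]; first by right.
  by case: (Ep) => _ /dvdnP[k nk] _; left; exists k => //; case: k nk n0 => // ->.
(* both cases at once: n is a multiple of M when p = q, sieved out otherwise *)
set M := scale q.+1 in gL n'E nV *.
have dM : (exists2 k, 0 < k & n = k * M) -> exists j, d = j * M.
  by case=> k _ nk; case: dE => dE; [exists (k' - k)|exists (k - k')];
    rewrite mulnBl; lia.
have dfar : scale q + 2 * h q < 2 * d.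
  case: nV => [/dM[j jE]|nV].
    have : M <= d by rewrite jE leq_pmull//; case: j jE d0 => // ->.
    by rewrite /gap in gL; lia.
  rewrite ltnNge; apply/negP => dle; apply: nV; exists (2 * k').
  by rewrite -/M /gap -mulnA -n'E; case: dE => ?; split; lia.
split=> [|i]; first by lia.
case: (leqP i q) => iq; first by right; have := peak_le iq; lia.
have [c oc bE] := peak_odd_multiple iq; rewrite -/M in bE.
case: (ltnP (d + h q) (peak i)) => [|h1]; first by left.
case: (ltnP (peak i + h q) d) => [|h2]; first by right.
exfalso; rewrite /gap in gL.
case: nV => [/dM[j jE]|nV].
  (* d is a multiple of M, and peak i is close to an odd multiple of M / 2 *)
  have cj : 2 * j != c by apply/eqP => cE; move: oc; rewrite -cE oddM.
  by case: (ltngtP (2 * j) c) cj => // ? _; nia.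
apply: nV; case: dE => dE.
  have c2 : c < 2 * k'.
    have : c != 2 * k' by apply/eqP => cE; move: oc; rewrite cE oddM.
    by case: (ltngtP c (2 * k')) => // ? _; nia.
  exists (2 * k' - c); rewrite subn_gt0 c2 mulnBl -/M /gap; split=> //; lia.
exists (2 * k' + c); rewrite -/M /gap mulnDl; split; lia.
Qed.

Lemma sieve_dist p q n n' : sieve p n -> sieve q n' -> n < n' ->
  h (maxn p q) < n' - n /\
  forall i, n' - n + h (maxn p q) < peak i \/ peak i + h (maxn p q) < n' - n.
Proof.
move=> Ep Eq nn'; have d0 : 0 < n' - n by rewrite subn_gt0.
by case: (leqP p q) => [pq|/ltnW qp];
  [apply: (sieve_dist_le pq Ep Eq)|apply: (sieve_dist_le qp Eq Ep)] => //; lia.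
Qed.

(** The elements themselves stay away from the peaks, at a distance
which, unlike that of the differences, takes the index of the peak into
account. For a high peak this is the case [k = 1] of [near_half_multiple]: the
peak [i.+1] is one half below [scale i.+1 / 2]. *)
Lemma sieve_peak p n i : sieve p n ->
  n + h (maxn i.-1 p) < peak i \/ peak i + h (maxn i.-1 p) < n.
Proof.
move=> Ep; have nM := sieve_ge Ep; have [n0 /dvdnP[k nk] nV] := Ep.
have gL := scale_gap4 p; have sp := scale_gt0 p.
case: (leqP i p) => ip.
  have -> : maxn i.-1 p = p by apply/maxn_idPr; lia.
  by right; have := peak_le ip; rewrite /gap in gL; lia.
case: i ip => // i; rewrite ltnS /= => ip.
have -> : maxn i p = i by apply/maxn_idPl.
have bE := double_peak i.+1.
case: (ltnP (n + h i) (peak i.+1)) => [|h1]; first by left.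
case: (ltnP (peak i.+1 + h i) n) => [|h2]; first by right.
exfalso; move: ip; rewrite leq_eqVlt => /predU1P[pi|/nV]; last first.
  by case; exists 1; rewrite /gap; split => //; lia.
subst p; rewrite /gap in gL; lia.
Qed.

(** Explicit enumeration, by multiple [k.+1] and offset [e], of the integers up
to [N] which are near a half-multiple; its length is easier to bound than the
number of these integers. *)
Definition near_list q N := [seq (k.+1 * scale q.+1 + e - gap q)./2
  | k <- iota 0 ((2 * N + gap q) %/ scale q.+1), e <- iota 0 (2 * gap q).+1].

Lemma near_listP q N n : n <= N -> near_half_multiple q n -> n \in near_list q N.
Proof.
move=> nN [[|k] [k0 h1 h2]]; first by [].
apply/allpairsP; exists (k, 2 * n + gap q - k.+1 * scale q.+1); split; rewrite ?mem_iota /=.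
- rewrite add0n leq_divRL ?scale_gt0//. by lia.
- by lia.
- by rewrite subnKC// addnK mul2n doubleK.
Qed.

Lemma near_list_size q N :
  4 * scale q * 2 ^ q.+1 * size (near_list q N) <= N.
Proof.
rewrite size_allpairs !size_iota.
have := scale_gap q; have := scale_gap4 q; have := scale_gt0 q.
have g0 : 0 < gap q by rewrite /gap; lia.
have := leq_trunc_div (2 * N + gap q) (scale q.+1).
set K := _ %/ _; set M := scale _.+1; set G := gap q in g0 *.
move: (2 ^ _) (scale q) => x y MK y0 GM xM.
case: (posnP K) => [->|K0]; first by rewrite mul0n muln0.
(* K > 0 forces M <= 2 N + G, so that G <= 2 N as M >= 4 G *)
have MK4 : K * M <= 4 * N by nia.
rewrite -(leq_pmul2l (isT : 0 < 16)).
apply: leq_trans (_ : 4 * (K * (48 * x * G * y)) <= _); first by nia.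
by apply: leq_trans (_ : 4 * (K * M) <= _); nia.
Qed.

Lemma near_list_size_sum p t N :
  4 * scale p.+1 * size (flatten [seq near_list q N | q <- iota p.+1 t]) <= N.
Proof.
(* the geometric sum, cleared of denominators to allow induction on t *)
suff : 4 * scale p.+1 * (2 ^ t * size (flatten [seq near_list q N | q <- iota p.+1 t]))
   <= N * (2 ^ t - 1).
  have x0 : 0 < 2 ^ t by rewrite expn_gt0.
  rewrite mulnCA => /leq_trans bound; rewrite -(leq_pmul2l x0); apply: bound.
  by rewrite mulnC leq_mul2r leq_subr orbT.
elim: t => [|t IH]; first by rewrite muln0.
have -> : iota p.+1 t.+1 = rcons (iota p.+1 t) (p.+1 + t).
  by rewrite -[t.+1]addn1 iotaD cats1.
rewrite map_rcons flatten_rcons size_cat.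
have H : 4 * scale p.+1 * 2 ^ t.+1 * size (near_list (p.+1 + t) N) <= N.
  apply: leq_trans (near_list_size (p.+1 + t) N).
  rewrite leq_mul2r leq_mul ?orbT// ?leq_exp2l//; last by lia.
  by rewrite leq_mul2l /= scale_le//; lia.
have : 0 < 2 ^ t by rewrite expn_gt0.
move: IH H; rewrite expnS; move: (2 ^ t) (size _) (size _) (scale _) => x y z s.
nia.
Qed.

Lemma near_half_multiple_ge q n : near_half_multiple q n -> q <= n.
Proof.
case=> k [k0 _ h2]; have := scale_gap4 q; have := scale_gtid q.
rewrite /gap in h2 *; nia.
Qed.

(** Of the [N %/ scale p.+1] multiples of [scale p.+1] up to [N], at most
[N / (4 * scale p.+1)] are removed at the levels above [p]; only levels up to
[N] matter, by [near_half_multiple_ge]. *)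
Lemma sieve_count p N : 8 * scale p.+1 <= N ->
  N.+1 <= 4 * scale p.+1 * count (fun n => `[< sieve p n >]) (iota 0 N.+1).
Proof.
move=> LN; have M0 := scale_gt0 p.+1.
set M := scale p.+1 in LN M0 *; set P := fun _ => _.
set V := flatten [seq near_list q N | q <- iota p.+1 N].
have sz : N %/ M <= count P (iota 0 N.+1) + size V.
  rewrite -size_filter -size_cat -(size_iota 1 (N %/ M)) -(size_map (muln M)).
  apply: uniq_leq_size.
    rewrite map_inj_uniq ?iota_uniq// => x y /eqP.
    by rewrite eqn_pmul2l// => /eqP.
  move=> _ /mapP[k + ->]; rewrite mem_iota add1n ltnS => /andP[k0 kN].
  have kMN : M * k <= N by rewrite mulnC -leq_divRL.
  rewrite mem_cat mem_filter mem_iota /= add0n ltnS kMN andbT.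
  case: (boolP (P _)) => //= /asboolP nS.
  have [q [pq nV]] : exists q, p < q /\ near_half_multiple q (M * k).
    apply: contra_notP nS => /forallNP nS; split; first by rewrite muln_gt0 M0.
    - exact: dvdn_mulr.
    - by move=> q pq nV; apply: (nS q).
  apply/flatten_mapP; exists q; last exact: near_listP.
  by rewrite mem_iota pq; have := near_half_multiple_ge nV; lia.
have := near_list_size_sum p N N; rewrite -/V -/M.
have := ltn_ceil N M0; move: sz.
move: (count _ _) (size V) (N %/ M) => c v k; rewrite mulSn => *; nia.
Qed.

End sieve.

Local Open Scope classical_set_scope.
Local Open Scope ring_scope.

(** * Topology of c_0(A), and what continuity and chaos say about the weights *)

Section c0.
Variable R : realType.
Implicit Types (a : kothe_matrix R).

Local Notation c0 a := (kothe_space a (KotheZero R)).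

Lemma normc_ge0 (z : R[i]) : 0 <= normc z.
Proof. by case: z => u v; exact: sqrtr_ge0. Qed.

Lemma normc_real (r : R) : 0 <= r -> normc r%:C%C = r.
Proof. by move=> r0; rewrite /normc/= expr0n/= addr0 sqrtr_sqr ger0_norm. Qed.

Lemma normc_realM (r : R) (z : R[i]) : 0 <= r -> normc (r%:C%C * z) = r * normc z.
Proof. by move=> r0; rewrite normcM normc_real. Qed.

Lemma kothe_coef_homo a m k n : (m <= k)%N -> a m n <= a k n.
Proof.
move/subnK <-; elim: (k - m)%N => // d IH.
by rewrite addSn (le_trans IH)// kothe_coef_le.
Qed.

Lemma kothe_coef_ge0 a m n : 0 <= a m n.
Proof. exact/ltW/kothe_coef_gt0. Qed.

(** Since the rows increase, only the last of the seminorms in the definition of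
a ball matters. The bound [e'] expresses that the supremum is less than [e]. *)
Lemma c0_ballP a (x y : c0 a) M (e : R) :
  kothe_ball x M e y <->
  exists2 e', e' < e & forall n, normc (y n - x n) * a M n <= e'.
Proof.
split=> [/(_ M (leqnn M))|[e' e'e bnd] m mM]; last first.
  apply: (@le_lt_trans _ _ e'%:E); last by rewrite lte_fin.
  apply: ge_ereal_sup => _ [n _ <-]; rewrite lee_fin (le_trans _ (bnd n))//.
  by rewrite ler_wpM2l ?normc_ge0// kothe_coef_homo.
rewrite /kothe_seminorm; set s := ereal_sup _ => se.
have ub n : ((normc (y n - x n) * a M n)%:E <= s)%E.
  by apply: ereal_sup_ubound; exists n.
have s0 : (0 <= s)%E.
  by apply: le_trans (ub 0%N); rewrite lee_fin mulr_ge0 ?normc_ge0 ?kothe_coef_ge0.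
have sfin : s \is a fin_num by rewrite ge0_fin_numE// (lt_trans se)// ltry.
exists (fine s) => [|n]; first by rewrite -lte_fin fineK.
by rewrite -lee_fin fineK.
Qed.

Lemma c0_ball_open a (x : c0 a) M e : open (kothe_ball x M e).
Proof.
move=> y /c0_ballP[e' e'e ye']; exists M, (e - e'); split; first by rewrite subr_gt0.
move=> z /c0_ballP[e'' e''e ze'']; apply/c0_ballP; exists (e' + e''); first by lra.
move=> n; apply: (le_trans _ (lerD (ye' n) (ze'' n))).
rewrite -mulrDl ler_wpM2r ?kothe_coef_ge0//.
by rewrite -[z n - x n](subrKA (y n)) addrC le_normcD.
Qed.

Lemma c0_openP a (U : set (c0 a)) :
  open U <-> forall x, U x -> exists M (e : R), 0 < e /\ kothe_ball x M e `<=` U.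
Proof. by []. Qed.

Lemma finite_support_c0 a (z : nat -> R[i]) N :
  (forall n, (N <= n)%N -> z n = 0) -> kothe_set a (KotheZero R) z.
Proof.
move=> z0 m; apply: cvg_near_cst; exists N => // n /= Nn.
by rewrite z0// normc0 mul0r.
Qed.

Definition single n (t : R[i]) : nat -> R[i] := fun i => if i == n then t else 0.

Lemma single_c0 a n t : kothe_set a (KotheZero R) (single n t).
Proof.
by apply: (@finite_support_c0 _ _ n.+1) => i ni; rewrite /single gtn_eqF.
Qed.

(** Continuity at 0, tested on small multiples of the unit sequences. *)
Lemma c0_shift_continuous a (w : nat -> R) (T : c0 a -> c0 a) :
  (forall n, 0 < w n) ->
  (forall x, kothe_seq (T x) = weighted_shift w (kothe_seq x)) ->
  continuous T ->
  forall m, exists k, exists2 C, 0 < C & forall n, w n.+1 * a m n <= C * a k n.+1.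
Proof.
move=> w0 TE Tc m.
pose o : c0 a := KotheSpace (@single_c0 a 0 0).
have oE i : kothe_seq o i = 0 by rewrite /= /single; case: ifP.
have ToE i : kothe_seq (T o) i = 0 by rewrite TE /weighted_shift oE mulr0.
have /continuousP/(_ _ (@c0_ball_open a o m 1))/c0_openP/(_ o) := Tc.
case=> [|k [e [e0 sub]]].
  apply/c0_ballP; exists 0 => // n.
  by rewrite ToE oE subrr normc0 mul0r.
exists k, (2 / e) => [|n]; first by rewrite divr_gt0.
have ak := kothe_coef_gt0 a k n.+1.
(* the multiple of the unit sequence that has half the allowed norm *)
pose t := e / 2 / a k n.+1.
have t0 : 0 < t by rewrite !divr_gt0.
pose x : c0 a := KotheSpace (@single_c0 a n.+1 t%:C%C).
have /sub/c0_ballP[e' e'1 /(_ n)] : kothe_ball o k e x.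
  apply/c0_ballP; exists (e / 2); first by lra.
  move=> i; rewrite oE subr0 /= /single; case: eqP => [->|_].
    by rewrite normc_real ?(ltW t0)// mulfVK ?gt_eqF.
  by rewrite normc0 mul0r ltW// divr_gt0.
rewrite oE subr0 TE /weighted_shift /= /single eqxx.
rewrite normc_realM ?(ltW (w0 _))// normc_real ?(ltW t0)// => /le_lt_trans/(_ e'1)/ltW.
move=> le1; rewrite -(ler_pM2l t0).
apply: (le_trans (_ : _ <= 1)); first by rewrite mulrA [t * _]mulrC.
have -> // : t * (2 / e * a k n.+1) = 1.
rewrite /t; field. by rewrite !gt_eqF.
Qed.

Definition weight_prod (w : nat -> R) n := \prod_(i < n) w i.+1.

Lemma weight_prodS w n : weight_prod w n.+1 = weight_prod w n * w n.+1.
Proof. by rewrite /weight_prod big_ord_recr. Qed.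

Lemma weight_prod_gt0 w n : (forall n, 0 < w n) -> 0 < weight_prod w n.
Proof. by move=> w0; apply: prodr_gt0. Qed.

Lemma weighted_shift_iter a w (T : c0 a -> c0 a) :
  (forall x, kothe_seq (T x) = weighted_shift w (kothe_seq x)) ->
  forall x k n, (weight_prod w n)%:C%C * (iter k T x) n
                = (weight_prod w (n + k))%:C%C * x (n + k)%N.
Proof.
move=> TE x; elim=> [|k IH] n; first by rewrite addn0.
rewrite iterS TE /weighted_shift mulrA -rmorphM/= -weight_prodS IH.
by rewrite addSnnS.
Qed.

(** If [x] has period [d], the coordinate of [iter j T x] at [n] is
[x 0 / weight_prod w n] whenever [d] divides [n + j]. For each [n] some [j < d]
does it, and the [d] vectors [iter j T x] all have small coordinates far out.
Density of the periodic points provides one with [x 0 != 0]. *)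
Lemma c0_chaotic_cvg a w : supports_shift a (KotheZero R) (@chaotic (c0 a)) w ->
  forall m, (fun n => a m n / weight_prod w n) @ \oo --> (0 : R).
Proof.
move=> [w0 [T [TE _ [_ dper]]]] m.
pose O : set (c0 a) := [set x | x 0%N != 0].
have Oopen : open O.
  apply/c0_openP => x x0.
  exists 0%N, (normc (x 0%N) * a 0%N 0%N).
  have nx0 : 0 < normc (x 0%N).
    rewrite lt_neqAle normc_ge0 andbT eq_sym; apply: contra x0 => /eqP.
    by move/eq0_normc => ->.
  split; first by rewrite mulr_gt0// kothe_coef_gt0.
  move=> y /c0_ballP[e' e'e /(_ 0%N)] ye; apply/negP => /eqP y0.
  by move: ye; rewrite y0 sub0r normcN => /le_lt_trans/(_ e'e); rewrite ltxx.
have [|x [/= x0 [d d0 xd]]] := dper O _ Oopen.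
  by exists (KotheSpace (@single_c0 a 0 1)); rewrite /O/= /single eqxx oner_neq0.
have nx0 : 0 < normc (x 0%N).
  rewrite lt_neqAle normc_ge0 andbT eq_sym; apply: contra x0 => /eqP.
  by move/eq0_normc => ->.
have xdk k : iter (k * d) T x = x by elim: k => // k IH; rewrite mulSn iterD IH.
have coordE j N : (d %| N + j)%N ->
    normc (iter j T x N) = normc (x 0%N) / weight_prod w N.
  case/dvdnP => k kE; have vN := weight_prod_gt0 N w0.
  have := weighted_shift_iter TE x j N; rewrite kE.
  have := weighted_shift_iter TE x (k * d) 0; rewrite add0n xdk => <-.
  have -> : weight_prod w 0 = 1 by rewrite /weight_prod big_ord0.
  rewrite mul1r => <-.
  by rewrite normc_realM ?ltW// mulrAC divff ?mul1r// gt_eqF.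
apply/cvgr0Pnorm_lt => e e0.
have e'0 : 0 < e * normc (x 0%N) by rewrite mulr_gt0.
have : \forall n \near \oo, forall j : 'I_d,
    normc (iter j T x n) * a m n < e * normc (x 0%N).
  apply: filter_forall => j.
  have /cvgr0Pnorm_lt/(_ _ e'0) := kothe_seqP (iter j T x) m.
  by apply: filterS => n; rewrite ger0_norm// mulr_ge0 ?normc_ge0 ?kothe_coef_ge0.
apply: filterS => n /(_ (Ordinal (ltn_pmod (d - n %% d) d0)))/=.
rewrite coordE; last first.
  rewrite /dvdn modnDmr -modnDml subnKC ?modnn//.
  by rewrite ltnW// ltn_pmod.
have v0 := weight_prod_gt0 n w0.
rewrite mulrAC -mulrA [normc _ * _]mulrC ltr_pM2r//.
by rewrite ger0_norm// divr_ge0 ?kothe_coef_ge0// ltW.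
Qed.

End c0.

(** * The matrix, and why no weighted shift is chaotic on its space *)

Section since.
Variable b : nat -> nat.
Local Open Scope nat_scope.

(** Distance from [n] down to the last value of [b], or down to 0; an increasing
[b] only takes the value [n] at an index at most [n]. *)
Fixpoint since n :=
  if n is n'.+1 then if [exists i : 'I_n.+1, b i == n] then 0 else (since n').+1
  else 0.

Lemma since_marker : (forall i, b i < b i.+1) -> forall i, since (b i) = 0.
Proof.
move=> b_lt i.
have ib : i <= b i by elim: i => // i IH; apply: leq_trans (b_lt i).
case bE : (b i) => [//|n] /=; case: existsP => // -[].
have in1 : i < n.+2 by rewrite ltnS -bE.
by exists (Ordinal in1); rewrite /= bE.
Qed.

Lemma sinceS n : since n.+1 <= (since n).+1.
Proof. by rewrite /=; case: ifP. Qed.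

Lemma since_le n : since n <= n.
Proof. by elim: n => // n IH; apply: leq_trans (sinceS n) _. Qed.

Lemma since_lastP : b 0 = 0 -> forall n, exists2 i, b i <= n & since n = n - b i.
Proof.
move=> b0 n.
elim: n => [|n [i bn sn]] /=; first by exists 0; rewrite b0.
case: existsP => [[j /eqP bj]|_]; first by exists j; rewrite bj ?subnn.
by exists i; rewrite ?sn ?subSn// leqW.
Qed.

End since.

Lemma since_le_sub b : (forall i, b i < b i.+1)%N ->
  forall i n, (b i <= n)%N -> (since b n <= n - b i)%N.
Proof.
move=> b_lt i n /subnKC <-; rewrite addKn; elim: (n - b i)%N => [|d IH].
  by rewrite addn0 since_marker.
by rewrite addnS (leq_trans (sinceS _ _)).
Qed.

Section growth.
Local Open Scope nat_scope.

(** The product of the [tower k] for [0 < k <= n], made primitive so that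
[tower] can be defined from it. *)
Fixpoint tower_prod n :=
  if n is m.+1 then tower_prod m * ((2 ^ n * n) ^ n * tower_prod m ^ n) else 1.

Definition tower n := if n is m.+1 then (2 ^ n * n) ^ n * tower_prod m ^ n else 1.

Lemma tower_prodS n : tower_prod n.+1 = tower_prod n * tower n.+1.
Proof. by []. Qed.

Lemma tower_gt0 n : 0 < tower n.
Proof.
have towerS m : 0 < tower_prod m -> 0 < tower m.+1.
  by move=> p0; rewrite /tower muln_gt0 !expn_gt0 muln_gt0 expn_gt0 p0.
suff p0 m : 0 < tower_prod m by case: n => // n; exact: towerS.
by elim: m => // m IH; rewrite tower_prodS muln_gt0 IH towerS.
Qed.

Lemma tower_prod_gt0 n : 0 < tower_prod n.
Proof. by elim: n => // n IH; rewrite tower_prodS muln_gt0 IH tower_gt0. Qed.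

Lemma tower_le n : tower n <= tower n.+1.
Proof.
apply: (@leq_trans (tower_prod n)).
  by case: n => // n; rewrite tower_prodS leq_pmull// tower_prod_gt0.
apply: (@leq_trans (tower_prod n ^ n.+1)).
  by rewrite expnS leq_pmulr// expn_gt0 tower_prod_gt0.
by rewrite /tower leq_pmull// !expn_gt0 muln_gt0 expn_gt0.
Qed.

(** The left side dominates the part of the product of the weights up to [n.+1]
that does not come from [tower n.+1] itself. *)
Lemma tower_large C k n : C <= n.+1 -> k <= n.+1 ->
  (C * 2 ^ n.+1) ^ n.+1 * tower_prod n ^ k <= tower n.+1.
Proof.
move=> Cn kn; rewrite /tower leq_mul//.
  by rewrite leq_exp2r// mulnC leq_mul2l Cn orbT.
by rewrite leq_pexp2l// tower_prod_gt0.
Qed.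

End growth.

Arguments since : simpl never.
Arguments tower : simpl never.
Arguments tower_prod : simpl never.

Section matrix.
Variable R : realType.
Variable b : nat -> nat.

Definition spike_coef m n : R :=
  (tower n ^ (m - since b n))%:R / 2 ^+ since b n.

Lemma spike_coef_gt0 m n : 0 < spike_coef m n.
Proof. by rewrite divr_gt0 ?exprn_gt0// ltr0n expn_gt0 tower_gt0. Qed.

Lemma spike_coef_le m n : spike_coef m n <= spike_coef m.+1 n.
Proof.
rewrite ler_pM2r ?invr_gt0 ?exprn_gt0// ler_nat leq_pexp2l ?tower_gt0//.
by rewrite leq_sub2r.
Qed.

Definition spike := KotheMatrix spike_coef_gt0 spike_coef_le.

(** One step to the right loses at most one factor of [tower], which the next row
regains, and at most one factor 2. *)
Lemma spike_shift m n : spike m n <= 2 * spike m.+1 n.+1.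
Proof.
rewrite /= /spike_coef; set s := since b n; set s' := since b n.+1.
have ss : (s' <= s.+1)%N := sinceS b n.
apply: (@le_trans _ _ ((tower n.+1 ^ (m.+1 - s'))%:R / 2 ^+ s)).
  rewrite ler_pM2r ?invr_gt0 ?exprn_gt0// ler_nat.
  apply: (@leq_trans (tower n.+1 ^ (m - s))).
    by case: (m - s)%N => // d; rewrite leq_exp2r// tower_le.
  by rewrite leq_pexp2l ?tower_gt0//; lia.
rewrite mulrCA ler_pM2l ?ltr0n ?expn_gt0 ?tower_gt0//.
rewrite ler_pdivlMr ?exprn_gt0// mulrC ler_pdivrMr ?exprn_gt0// -exprS.
by rewrite ler_weXn2l// ler1n.
Qed.

Lemma spike_small m n : (m <= since b n)%N -> spike m n = 2 ^- since b n.
Proof.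
by rewrite /= /spike_coef -subn_eq0 => /eqP ->; rewrite expn0 mul1r.
Qed.

(** Row 0 is at least [2 ^- n], so that comparing it with row [k] at the next index
bounds each weight, hence their product, with [k] factors [tower n] for the
last index [n]. At a peak, row [k.+1] has one more such factor, which by
[tower_large] outweighs all the rest of the bound. *)
Lemma spike_no_chaos w : (forall i, (b i < b i.+1)%N) ->
  ~ supports_shift spike (KotheZero R) (@chaotic (kothe_space spike (KotheZero R))) w.
Proof.
move=> b_lt sw; have cv := c0_chaotic_cvg sw.
have [w0 [T [TE Tc _]]] := sw.
have [k [C0 C00 wC0]] := c0_shift_continuous w0 TE Tc 0.
have [C CE] : exists C : nat, C0 <= C%:R.
  by exists (Num.bound C0); rewrite ltW// archi_boundP// ltW.
have wC n : w n.+1 <= (C * 2 ^ n * tower n.+1 ^ k)%:R.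
  have := wC0 n; have := since_le b n; have := since_le b n.+1.
  rewrite /= /spike_coef sub0n expn0 mul1r.
  set s := since b n; set s' := since b n.+1 => s'n sn.
  rewrite ler_pdivrMr ?exprn_gt0// => /le_trans; apply.
  rewrite !natrM !natrX mulrAC; apply: ler_pM.
  - by rewrite mulr_ge0 ?exprn_ge0 ?(ltW C00).
  - by rewrite divr_ge0 ?exprn_ge0.
  - by rewrite ler_pM ?exprn_ge0 ?(ltW C00)// ler_weXn2l// ler1n.
  rewrite ler_pdivrMr ?exprn_gt0// -[leLHS]mulr1 ler_pM//.
    by rewrite ler_weXn2l ?leq_subr// ler1n tower_gt0.
  by rewrite exprn_ege1// ler1n.
have vC n : weight_prod w n <= ((C * 2 ^ n) ^ n * tower_prod n ^ k)%:R.
  elim: n => [|n IH]; first by rewrite /weight_prod big_ord0 expn0 exp1n.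
  rewrite weight_prodS (le_trans (ler_pM _ _ IH (wC n)))//.
  - exact/ltW/weight_prod_gt0.
  - exact/ltW.
  rewrite -natrM ler_nat tower_prodS [((_ * tower _) ^ k)%N]expnMn mulnACA leq_mul//.
  by rewrite -expnSr leq_exp2r// leq_mul2l leq_pexp2l ?orbT.
have b_ge i : (i <= b i)%N by elim: i => // i IH; apply: leq_trans (b_lt i).
have /cvgr0Pnorm_lt/(_ 1 ltr01)[N _ Nlt] := cv k.+1.
(* a peak beyond N, C and k, and different from 0 where tower is trivial *)
pose i := (maxn 1 (maxn N (maxn C k)))%N.
have := b_ge i; have := since_marker b_lt i; case bE : (b i) => [|n] si ib.
  by move: ib; rewrite /i; lia.
have /Nlt : (N <= n.+1)%N by move: ib; rewrite /i; lia.
apply/negP; rewrite -leNgt ger0_norm; last first.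
  by rewrite divr_ge0 ?kothe_coef_ge0// ltW// weight_prod_gt0.
rewrite ler_pdivlMr ?weight_prod_gt0// mul1r (le_trans (vC _))//.
rewrite /= /spike_coef si subn0 expr0 divr1 ler_nat tower_prodS.
rewrite [((_ * tower _) ^ k)%N]expnMn mulnA mulnC [(tower _ ^ k.+1)%N]expnSr leq_mul2l.
by rewrite tower_large ?orbT//; move: ib; rewrite /i; lia.
Qed.

End matrix.

Arguments spike : simpl never.

(** * A countable dense set of finitely supported vectors *)

Section dense.
Variable R : realType.

Lemma normc_le_parts (u v : R) : normc (u +i* v)%C <= `|u| + `|v|.
Proof.
rewrite /normc -[leRHS]ger0_norm ?addr_ge0// -sqrtr_sqr ler_wsqrtr//.
by rewrite sqrrD !real_normK ?num_real// lerD2r lerDl mulrn_wge0 ?mulr_ge0.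
Qed.

Lemma rat_approx (r e : R) : 0 < e -> exists q : rat, `|ratr q - r| < e.
Proof.
move=> e0; have /rat_in_itvoo[q] : r - e < r + e by lra.
by rewrite in_itv/= -ltr_distl => qr; exists q.
Qed.

Definition rat_complex (u : rat * rat) : R[i] := (ratr u.1 +i* ratr u.2)%C.

Lemma rat_complex_approx (z : R[i]) (e : R) : 0 < e ->
  exists u, normc (rat_complex u - z) < e.
Proof.
move=> e0; case: z => s t; have e2 : 0 < e / 2 by rewrite divr_gt0.
have [q qs] := rat_approx s e2; have [q' q't] := rat_approx t e2.
exists (q, q'); apply: (le_lt_trans (normc_le_parts _ _)) => /=; lra.
Qed.

(** The vector only depends on the exponent of 2 in the index [p]: this makes each
vector occur infinitely often. *)
Definition vectors p : seq R[i] :=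
  if @unpickle (seq (rat * rat)) (logn 2 p) is Some l then map rat_complex l else [::].

Lemma vectors_dense (z : nat -> R[i]) K (e : R) P : 0 < e ->
  exists p, [/\ (P <= p)%N, size (vectors p) = K
    & forall j, (j < K)%N -> normc ((vectors p)`_j - z j) < e].
Proof.
move=> e0; have /choice[u uz] j := rat_complex_approx (z j) e0.
exists (2 ^ pickle (mkseq u K) * (2 * P).+1)%N.
have pE : logn 2 (2 ^ pickle (mkseq u K) * (2 * P).+1) = pickle (mkseq u K).
  rewrite lognM ?expn_gt0// pfactorK// [logn 2 _.+1]lognE dvdn2 mul2n /= odd_double.
  by rewrite addn0.
rewrite /vectors pE pickleK size_map size_mkseq; split=> // [|j jK].
  by rewrite -[leqLHS]mul1n leq_mul// ?expn_gt0// ; lia.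
by rewrite (nth_map (0, 0)) ?size_mkseq// nth_mkseq.
Qed.

End dense.

(** * A frequently hypercyclic vector *)

(** The set [E] is the one that gets counted, [F] the one of interest. *)
Lemma lower_density_gt0 (R : realType) (E F : set nat) c M : E `<=` F ->
  (forall N, M <= N -> N.+1 <= c * count (fun n => `[< E n >]) (iota 0 N.+1))%N ->
  (0 < lower_density R F)%E.
Proof.
move=> EF cnt; have c0 : (0 < c)%N by have := cnt M (leqnn M); case: (c).
rewrite /lower_density limn_einf_lim.
apply: (@lt_le_trans _ _ (c%:R^-1)%:E); first by rewrite lte_fin invr_gt0 ltr0n.
apply: lime_ge; first exact: is_cvg_einfs.
exists M => // n /= Mn; apply: le_ereal_inf_tmp => _ [N /= nN <-].
have -> : #|[pred k : 'I_N.+1 | `[< F k >]]| = count (fun n => `[< F n >]) (iota 0 N.+1).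
  rewrite cardE size_filter -enumT -val_enum_ord count_map.
  by apply: eq_count => k; rewrite /= inE.
rewrite lee_fin ler_pdivlMr ?ltr0n// mulrC ler_pdivrMr ?ltr0n//.
rewrite -natrM ler_nat mulnC (leq_trans (cnt _ (leq_trans Mn nN)))// leq_mul2l.
by rewrite sub_count ?orbT// => k /asboolP/EF Fk; apply/asboolP.
Qed.

Lemma exp2_small (R : realType) (e : R) m : 0 < e ->
  exists2 r, (m <= r)%N & 2 ^- r < e.
Proof.
move=> e0; exists (maxn m (Num.bound e^-1)); first exact: leq_maxl.
rewrite invf_plt ?posrE ?exprn_gt0// (lt_le_trans (archi_boundP _))//.
  by rewrite invr_ge0 ltW.
rewrite -natrX ler_nat (leq_trans _ (ltnW (ltn_expl _ _)))//.
exact: leq_maxr.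
Qed.

Section orbit.
Variable R : realType.
Variable y : nat -> seq R[i].
Variable g : nat -> nat.

(** At distance [room r] after a peak, the rows up to [r] are so small that they
stay below [2 ^- r] when multiplied by a coordinate of [y q], [q <= r]; and a
copy of such a [y q] is too short to cover this distance. *)
Definition room r := (\sum_(q < r.+1) g q + r)%N.

Lemma room_ge q r : (q <= r)%N -> (g q + r <= room r)%N.
Proof.
rewrite -ltnS => qr; rewrite leq_add2r (bigD1 (Ordinal qr))//=.
exact: leq_addr.
Qed.

Let b := peak room.
Let b_lt : forall i, (b i < b i.+1)%N := peak_lt room.
Local Notation a := (spike R b).
Local Notation E := (sieve room).


Lemma spike_tail m r q N (z : R[i]) : normc z <= 2 ^+ g q ->
  (m <= r)%N -> (g q + r <= since b N)%N -> normc z * a m N <= 2 ^- r.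
Proof.
move=> zq mr qrN; rewrite spike_small; last by lia.
apply: (@le_trans _ _ (2 ^+ g q / 2 ^+ (g q + r))).
  by rewrite ler_pM ?normc_ge0// lef_pV2 ?posrE ?exprn_gt0// ler_weXn2l// ler1n.
by rewrite exprD invfM mulrA divff ?mul1r// expf_neq0.
Qed.

Hypothesis y_size : forall q, (size (y q) <= g q)%N.

Definition block p n N := [/\ E p n, (n <= N)%N & (N < n + size (y p))%N].

Lemma block_uniq p q n n' N : block p n N -> block q n' N -> (p, n) = (q, n').
Proof.
wlog nn' : p q n n' / (n <= n')%N => [W|].
  by case: (leqP n n') => [/W|/ltnW/W W' bp bq]; [exact|rewrite (W' _ _ bq bp)].
move=> [Ep _ Nn] [Eq n'N _]; move: nn'; rewrite leq_eqVlt => /predU1P[nn'|nn'].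
  by rewrite nn' in Ep *; rewrite (sieve_disjoint Ep Eq).
have [d _] := sieve_dist Ep Eq nn'.
have := room_ge (leq_maxl p q); have := y_size p; lia.
Qed.

Definition orbit_vector N : R[i] :=
  if pselect (exists pn, block pn.1 pn.2 N) is left ex
  then let pn := projT1 (cid ex) in (y pn.1)`_(N - pn.2) else 0.

Lemma orbit_vector_block p n N : block p n N -> orbit_vector N = (y p)`_(N - n).
Proof.
rewrite /orbit_vector; case: pselect => [ex|nex] bp; last first.
  by case: nex; exists (p, n).
by case: cid => -[q n'] /= bq; case: (block_uniq bp bq) => -> ->.
Qed.

Lemma orbit_vectorP N : orbit_vector N = 0 \/
  exists p n, block p n N /\ orbit_vector N = (y p)`_(N - n).
Proof.
case: (pselect (exists pn, block pn.1 pn.2 N)) => [[[p n] /= bp]|nex].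
  by right; exists p, n; split=> //; exact: orbit_vector_block.
by left; rewrite /orbit_vector; case: pselect.
Qed.

Hypothesis y_normc : forall q j, normc (y q)`_j <= 2 ^+ g q.

(** A block far out starts far from all the peaks, at a distance which tends to
infinity with the index of the last peak. *)
Lemma orbit_vector_c0 : kothe_set a (KotheZero R) orbit_vector.
Proof.
move=> m; apply/cvgr0Pnorm_lt => e e0.
have [r mr re] : exists2 r, (m <= r)%N & 2 ^- r < e.
  exact: exp2_small.
exists (b r.+1) => // N /= rN.
rewrite ger0_norm ?mulr_ge0 ?normc_ge0 ?kothe_coef_ge0//.
apply: le_lt_trans re; case: (orbit_vectorP N) => [->|[p [n [[Ep nN Nn] ->]]]].
  by rewrite normc0 mul0r invr_ge0 exprn_ge0.
apply: (spike_tail (y_normc p _) mr).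
have [i iN sN] := since_lastP (peak0 room) N; rewrite -/b in iN sN *.
have ri : (r < i)%N.
  rewrite ltnNge; apply/negP => ir.
  have : (b i < b r.+1)%N by apply: (homo_ltn ltn_trans b_lt).
  by have := since_le_sub b_lt rN; lia.
have := y_size p; have := room_ge (leq_maxr i.-1 p).
by case: (sieve_peak i Ep); rewrite -/b; lia.
Qed.

(** After [n] shifts, the block of [y p] starting at [n] is in place, the blocks
before it have been shifted out, and the next ones start at differences of
elements of the sieved sets, hence far after a peak. *)
Lemma orbit_vector_approx p n m k : E p n -> (m <= p)%N ->
  normc (orbit_vector (n + k) - (y p)`_k) * a m k <= 2 ^- p.
Proof.
move=> Ep mp; case: (ltnP k (size (y p))) => kp.
  rewrite (@orbit_vector_block p n); last by split; rewrite ?leq_addr ?ltn_add2l.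
  by rewrite addKn subrr normc0 mul0r invr_ge0 exprn_ge0.
rewrite [X in _ - X]nth_default// subr0.
case: (orbit_vectorP (n + k)) => [->|[q [n' [[Eq n'k kn'] ->]]]].
  by rewrite normc0 mul0r invr_ge0 exprn_ge0.
have hq := room_ge (leq_maxr p q); have hp := room_ge (leq_maxl p q).
have yq := y_size q; have yp := y_size p.
case: (ltngtP n n') => nn'.
- apply: (spike_tail (y_normc q _) mp).
  have [_ d] := sieve_dist Ep Eq nn'.
  have [i iN ->] := since_lastP (peak0 room) k.
  by case: (d i); lia.
- have [d _] := sieve_dist Eq Ep nn'.
  by move: d; rewrite maxnC; lia.
- by rewrite -nn' in Eq kn'; move: kn'; rewrite (sieve_disjoint Eq Ep); lia.
Qed.

End orbit.

Section unit_shift.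
Variables (R : realType) (a : kothe_matrix R).
Hypothesis a_shift : forall m n, a m n <= 2 * a m.+1 n.+1.
Local Notation c0 := (kothe_space a (KotheZero R)).

Lemma unit_shift_c0 (x : c0) :
  kothe_set a (KotheZero R) (weighted_shift (fun=> 1) x).
Proof.
move=> m; apply/cvgr0Pnorm_lt => e e0.
have e2 : 0 < e / 2 by rewrite divr_gt0.
have /cvgr0Pnorm_lt/(_ _ e2)[N _ Ne] := kothe_seqP x m.+1.
exists N => // n /= Nn; have /Ne : (N <= n.+1)%N by exact: leqW.
rewrite !ger0_norm ?mulr_ge0 ?normc_ge0 ?kothe_coef_ge0// /weighted_shift mul1r.
have := ler_wpM2l (normc_ge0 (x n.+1)) (a_shift m n).
by rewrite mulrCA; lra.
Qed.

Definition unit_shift (x : c0) : c0 := KotheSpace (unit_shift_c0 x).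

Lemma unit_shift_iter (x : c0) n k : iter n unit_shift x k = x (n + k)%N.
Proof.
elim: n k => // n IH k.
by rewrite iterS /= /weighted_shift mul1r IH addnS.
Qed.

Lemma unit_shift_continuous : continuous unit_shift.
Proof.
apply/continuousP => U /c0_openP oU; apply/c0_openP => x /oU[M [e [e0 sub]]].
exists M.+1, (e / 2); split=> [|y /c0_ballP[e' e'e ye]]; first by rewrite divr_gt0.
apply: sub; apply/c0_ballP; exists (2 * e') => [|n]; first by lra.
rewrite /= /weighted_shift !mul1r.
have := ler_wpM2l (normc_ge0 (y n.+1 - x n.+1)) (a_shift M n).
by rewrite mulrCA => /le_trans; apply; rewrite ler_pM2l.
Qed.

End unit_shift.

Lemma seq_bound (R : realType) (s : seq R[i]) :
  exists g, (size s <= g)%N /\ forall j, normc s`_j <= 2 ^+ g.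
Proof.
elim: s => [|z s [g [sg gs]]].
  by exists 0%N; split=> // j; rewrite nth_nil normc0 exprn_ge0.
exists (maxn g.+1 (Num.bound (normc z))); split=> [|[|j] /=].
- exact: (leq_trans _ (leq_maxl _ _)).
- apply/ltW/(lt_le_trans (archi_boundP (normc_ge0 z))).
  by rewrite -natrX ler_nat (leq_trans (ltnW (ltn_expl _ (ltnSn 1))))// leq_pexp2l// leq_maxr.
- rewrite (le_trans (gs j))// ler_weXn2l// ?ler1n//.
  by rewrite (leq_trans _ (leq_maxl _ _)).
Qed.

(** To approach [z] in row [M]: cut [z] at [K], beyond which it is small; choose
[y p] close to the rest, with [p] so large that the error [2 ^- p] of
[orbit_vector_approx] is small and covers row [M]. *)
Lemma orbit_frequently_hypercyclic (R : realType) (y : nat -> seq R[i]) g :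
  (forall q, (size (y q) <= g q)%N) ->
  (forall q j, normc (y q)`_j <= 2 ^+ g q) ->
  (forall (z : nat -> R[i]) K (e : R) P, 0 < e ->
    exists p, [/\ (P <= p)%N, size (y p) = K
      & forall j, (j < K)%N -> normc ((y p)`_j - z j) < e]) ->
  frequently_hypercyclic R (unit_shift (@spike_shift R (peak (room g)))).
Proof.
move=> y_size y_normc y_dense; pose a := spike R (peak (room g)).
pose x : kothe_space a (KotheZero R) := KotheSpace (orbit_vector_c0 y_size y_normc).
exists x => U /c0_openP oU [z /oU[M [e [e0 sub]]]].
have e3 : 0 < e / 3 by rewrite divr_gt0.
have /cvgr0Pnorm_lt/(_ _ e3)[K _ zK] := kothe_seqP z M.
pose A := 1 + \sum_(j < K) a M j.
have A0 : 0 < A by rewrite ltr_pwDl// sumr_ge0// => j _; exact: kothe_coef_ge0.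
have aA j : (j < K)%N -> a M j <= A.
  move=> jK; rewrite /A (bigD1 (Ordinal jK))// addrCA lerDl addr_ge0// sumr_ge0// => i _.
  exact: (kothe_coef_ge0 a).
have [r Mr re] := exp2_small M e3.
have [p [rp pK py]] := y_dense z K (e / 3 / A) r (divr_gt0 e3 A0).
have pe : 2 ^- p < e / 3.
  by apply: le_lt_trans re; rewrite lef_pV2 ?posrE ?exprn_gt0// ler_weXn2l// ler1n.
apply: (@lower_density_gt0 R (sieve (room g) p)); last exact: sieve_count.
move=> n Ep; apply: sub; apply/c0_ballP; exists (2 * (e / 3)); first by lra.
move=> k; rewrite unit_shift_iter.
rewrite -[_ - z k](subrKA (y p)`_k) mulr_natl mulr2n.
apply: (@le_trans _ _ (normc (orbit_vector y g (n + k) - (y p)`_k) * a M k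
   + normc ((y p)`_k - z k) * a M k)).
  rewrite -mulrDl ler_wpM2r ?kothe_coef_ge0//.
  exact: le_normcD.
apply: lerD.
  by rewrite (le_trans _ (ltW pe))// orbit_vector_approx// (leq_trans Mr).
case: (ltnP k K) => kK.
  rewrite (le_trans (ler_pM _ _ (ltW (py _ kK)) (aA _ kK)))//.
  - exact: normc_ge0.
  - exact: kothe_coef_ge0.
  - by rewrite divfK// gt_eqF.
rewrite nth_default ?pK// sub0r normcN.
have := zK _ kK; rewrite ger0_norm; first exact: ltW.
by rewrite mulr_ge0 ?normc_ge0 ?kothe_coef_ge0.
Qed.

Theorem theorem1p3 (R : realType) :
  exists (a : kothe_matrix R) (o : kothe_order R),
    (exists w : nat -> R,
        supports_shift a o (@frequently_hypercyclic R (kothe_space a o)) w) /\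
    ~ (exists w : nat -> R,
        supports_shift a o (@chaotic (kothe_space a o)) w).
Proof.
have /choice[g gP] p := seq_bound (vectors R p).
exists (spike R (peak (room g))), (KotheZero R); split; last first.
  by case=> w; apply: spike_no_chaos; exact: peak_lt.
exists (fun=> 1); split=> [//|].
exists (unit_shift (@spike_shift R (peak (room g)))); split=> //.
  exact: unit_shift_continuous.
apply: (@orbit_frequently_hypercyclic R (vectors R)) => [q|q|].
- by case: (gP q).
- by case: (gP q).
- exact: vectors_dense.
Qed.
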